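(* Let $(M,F)$ be an $n$-dimensional smooth connected Finsler manifold satisfying the SC-condition, i.e. there is a nowhere-vanishing vector field $B=B^i(x)\,\partial/\partial x^i$ on $M$ with $B^h(x)\,C_{hij}(x,y)=0$ for all $i,j$ and all $(x,y)\in TM\setminus\{0\}$, where $C_{hij}$ is the Cartan tensor. Suppose that at least one of the following holds: (a) $\dim M=2$; (b) $\dim M=3$ and $F(x,-y)=F(x,y)$ for all $(x,y)\in TM$; (c) $(M,F)$ is C-reducible; (d) $(M,F)$ is Berwaldian and $\det(B^i{}_{|j})\neq 0$, where $B^i{}_{|j}$ is the horizontal covariant derivative of $B$ with respect to the Cartan connection. Then $(M,F)$ is Riemannian.
   Context: A Finsler structure on a smooth manifold $M$ is a function $F:TM\to\mathbb R$ with $F\ge 0$, $F(0)=0$; $F$ is $C^\infty$ on $TM\setminus\{0\}$ (the slit tangent bundle); $F(x,\lambda y)=\lambda F(x,y)$ for $\lambda>0$; and $g_{ij}(x,y):=\frac12\frac{\partial^2F^2}{\partial y^i\partial y^j}$ is positive definite at each point of $TM\setminus\{0\}$. Here $(x^i)$ are local coordinates on $M$ and $(x^i,y^i)$ the induced ones on $TM$; $\partial_i=\partial/\partial x^i$, $\dot\partial_i=\partial/\partial y^i$; $(g^{ij})$ is the inverse matrix of $(g_{ij})$; repeated indices are summed. Cartan tensor: $C_{ijk}:=\frac12\dot\partial_k g_{ij}=\frac14\dot\partial_i\dot\partial_j\dot\partial_kF^2$. $(M,F)$ is Riemannian if $C_{ijk}=0$ on $TM\setminus\{0\}$, equivalently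 $g_{ij}$ depends on $x$ only. Put $l_i:=\dot\partial_iF$, $h_{ij}:=g_{ij}-l_il_j$ (angular metric tensor), $C_i:=C_{ijk}g^{jk}$. $(M,F)$ of dimension $n\ge3$ is C-reducible if $C_{ijk}=\frac1{n+1}(h_{ij}C_k+h_{ki}C_j+h_{jk}C_i)$. Geodesic spray coefficients: $G^i=\frac14 g^{ih}\big(y^r\partial_r\dot\partial_hF^2-\partial_hF^2\big)$; $N^i_j:=\dot\partial_jG^i$; $\delta_i:=\partial_i-N^r_i\dot\partial_r$; $\Gamma^i_{jk}:=\frac12g^{ir}(\delta_jg_{kr}+\delta_kg_{jr}-\delta_rg_{jk})$. For a vector field $B^i(x)$, $B^i{}_{|j}:=\delta_jB^i+B^m\Gamma^i_{mj}$. $(M,F)$ is Berwaldian if $\dot\partial_i\dot\partial_j\dot\partial_kG^h=0$ for all $h,i,j,k$, i.e. the $G^h(x,y)$ are quadratic in $y$. *)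

(* Defs.v *)
From HB Require Import structures.
From mathcomp Require Import all_boot all_order all_algebra.
From mathcomp Require Import all_classical all_reals all_analysis.
Set Implicit Arguments.
Unset Strict Implicit.
Unset Printing Implicit Defensive.
Import Order.TTheory GRing.Theory Num.Theory numFieldNormedType.Exports.
Local Open Scope classical_set_scope.
Local Open Scope ring_scope.

(* Intended for an open set U of a finite-dimensional space V, where this is
   the usual notion: f is C^(k+1) iff it is differentiable with all its
   directional derivatives C^k. *)
Fixpoint Ck_on (R : realType) (V W : normedModType R) (k : nat)
    (U : set V) (f : V -> W) : Prop :=
  if k is k'.+1 then
    (forall x, U x -> differentiable f x) /\
    (forall v : V, Ck_on k' U ('D_v f))
  else forall x, U x -> {for x, continuous f}.

Definition smooth_on (R : realType) (V W : normedModType R)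
    (U : set V) (f : V -> W) : Prop := forall k, Ck_on k U f.

(* chart_map and chart_inv are total functions; only their restrictions to
   chart_dom and to its image are meaningful. *)
Record chart (R : realType) (n : nat) (M : topologicalType) := Chart {
  chart_dom : set M;
  chart_map : M -> 'rV[R]_n;
  chart_inv : 'rV[R]_n -> M;
  chart_dom_open : open chart_dom;
  chart_img_open : open (chart_map @` chart_dom);
  chart_mapK : forall p, chart_dom p -> chart_inv (chart_map p) = p;
  chart_map_continuous :
    forall p, chart_dom p -> {for p, continuous chart_map};
  chart_inv_continuous :
    forall x, (chart_map @` chart_dom) x -> {for x, continuous chart_inv} }.

Definition chart_img (R : realType) (n : nat) (M : topologicalType)
    (c : chart R n M) : set 'rV[R]_n := chart_map c @` chart_dom c.

Definition transition (R : realType) (n : nat) (M : topologicalType)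
    (c d : chart R n M) : 'rV[R]_n -> 'rV[R]_n :=
  chart_map d \o chart_inv c.

(* The atlas need not be maximal (nor is maximality excluded); every condition
   imposed below in all charts of the atlas is invariant under smooth changes
   of coordinates. *)
Record smooth_manifold (R : realType) (n : nat) (M : topologicalType) :=
  SmoothManifold {
  chart_index : Type;
  atlas :> chart_index -> chart R n M;
  atlas_cover : forall p, exists a, chart_dom (atlas a) p;
  atlas_smooth : forall a b,
    smooth_on (chart_map (atlas a) @`
                 (chart_dom (atlas a) `&` chart_dom (atlas b)))
              (transition (atlas a) (atlas b));
  manifold_hausdorff : hausdorff_space M;
  manifold_second_countable : @second_countable M }.

(* A tangent vector at p is a family of component vectors, one for each chart
   around p, related by the Jacobians of the transition maps. The components
   in charts not containing p are set to 0, so that tangent vectors are equal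
   as soon as their actual components are. *)
Record tangent (R : realType) (n : nat) (M : topologicalType)
    (A : smooth_manifold R n M) (p : M) := Tangent {
  tcoord : chart_index A -> 'rV[R]_n;
  tcoord_change : forall a b, chart_dom (A a) p -> chart_dom (A b) p ->
    tcoord b = 'd (transition (A a) (A b)) (chart_map (A a) p) (tcoord a);
  tcoord_off : forall a, ~ chart_dom (A a) p -> tcoord a = 0 }.

Definition tangent_bundle (R : realType) (n : nat) (M : topologicalType)
    (A : smooth_manifold R n M) := {p : M & tangent A p}.

Lemma diff_near_eq (R : realType) (V W : normedModType R) (f g : V -> W)
    (x v : V) :
  differentiable f x -> differentiable g x -> (\forall z \near x, f z = g z) ->
  'd f x v = 'd g x v.
Proof.
move=> df dg fg; rewrite -!deriveE // /derive.
have fgx : f x = g x by exact: nbhs_singleton fg.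
congr (lim _).
have sub (f1 g1 : V -> W) : f1 x = g1 x -> (\forall z \near x, f1 z = g1 z) ->
  (fun h : R => h^-1 *: ((f1 \o shift x) (h *: v) - f1 x)) @ 0^' `=>`
  (fun h : R => h^-1 *: ((g1 \o shift x) (h *: v) - g1 x)) @ 0^'.
  move=> e1 fg1; apply: near_eq_cvg.
  apply: nbhs_dnbhs.
  have c : (fun h : R => h *: v + x) @ 0 --> (0 : R) *: v + x.
    apply: cvgD; last exact: cvg_cst.
    exact: scalel_continuous.
  rewrite scale0r add0r in c.
  have fgh : \forall h \near (0 : R), f1 (h *: v + x) = g1 (h *: v + x).
    exact: (c _ fg1).
  by apply: filterS fgh => h /= eh; rewrite e1 eh.
apply/seteqP; split; last exact: (sub f g).
by apply: (sub g f) => //; apply: filterS fg => z ->.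
Qed.

Lemma diff_compE (R : realType) (U V W : normedModType R) (f : U -> V)
    (g : V -> W) (x v : U) (z : V) : f x = z ->
  differentiable f x -> differentiable g z ->
  'd (g \o f) x v = 'd g z ('d f x v).
Proof. by move=> <- df dg; rewrite diff_comp. Qed.

Lemma chart_imgP (R : realType) (n : nat) (M : topologicalType)
    (c : chart R n M) (x : 'rV[R]_n) : chart_img c x ->
  chart_dom c (chart_inv c x) /\ chart_map c (chart_inv c x) = x.
Proof. by move=> [p dp <-]; rewrite chart_mapK. Qed.

Lemma overlap_nbhs (R : realType) (n : nat) (M : topologicalType)
    (c d : chart R n M) (p : M) : chart_dom c p -> chart_dom d p ->
  \forall x \near chart_map c p, chart_img c x /\ chart_dom d (chart_inv c x).
Proof.
move=> cp dp; have icp : chart_img c (chart_map c p) by exists p.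
have img_nbhs : nbhs (chart_map c p) (chart_img c).
  by apply: open_nbhs_nbhs; split => //; exact: chart_img_open.
have dom_nbhs : nbhs (chart_inv c (chart_map c p)) (chart_dom d).
  by rewrite chart_mapK //; apply: open_nbhs_nbhs; split => //;
    exact: chart_dom_open.
exact: (filterI img_nbhs (chart_inv_continuous icp dom_nbhs)).
Qed.

Lemma transition_differentiable (R : realType) (n : nat) (M : topologicalType)
    (A : smooth_manifold R n M) (a b : chart_index A) (p : M) :
  chart_dom (A a) p -> chart_dom (A b) p ->
  differentiable (transition (A a) (A b)) (chart_map (A a) p).
Proof.
by move=> ap bp; have [+ _] := @atlas_smooth _ _ _ A a b 1; apply; exists p.
Qed.

Lemma transition_id (R : realType) (n : nat) (M : topologicalType)
    (A : smooth_manifold R n M) (a : chart_index A) (p : M) (y : 'rV[R]_n) :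
  chart_dom (A a) p -> 'd (transition (A a) (A a)) (chart_map (A a) p) y = y.
Proof.
move=> ap.
rewrite (@diff_near_eq _ _ _ _ id); first by rewrite diff_val.
- exact: transition_differentiable.
- exact: ex_diff.
- by apply: filterS (overlap_nbhs ap ap) => x [/chart_imgP[_ ?] _].
Qed.

Lemma transition_cocycle (R : realType) (n : nat) (M : topologicalType)
    (A : smooth_manifold R n M) (a b c : chart_index A) (p : M)
    (y : 'rV[R]_n) :
  chart_dom (A a) p -> chart_dom (A b) p -> chart_dom (A c) p ->
  'd (transition (A a) (A c)) (chart_map (A a) p) y =
  'd (transition (A b) (A c)) (chart_map (A b) p)
    ('d (transition (A a) (A b)) (chart_map (A a) p) y).
Proof.
move=> ap bp cp.
have e : transition (A a) (A b) (chart_map (A a) p) = chart_map (A b) p.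
  by rewrite /transition /= chart_mapK.
have dab := transition_differentiable ap bp.
have dbc := transition_differentiable bp cp.
apply: etrans (diff_compE y e dab dbc).
apply: diff_near_eq; [exact: transition_differentiable | |].
  by apply: differentiable_comp => //; rewrite e.
apply: filterS (overlap_nbhs ap bp) => x [_ bx].
by rewrite /transition /= chart_mapK.
Qed.

Section TangentOfCoord.
Context (R : realType) (n : nat) (M : topologicalType).
Context (A : smooth_manifold R n M).

Definition coord_family (a : chart_index A) (p : M) (y : 'rV[R]_n)
    (b : chart_index A) : 'rV[R]_n :=
  if `[< chart_dom (A a) p /\ chart_dom (A b) p >]
  then 'd (transition (A a) (A b)) (chart_map (A a) p) y else 0.

Fact coord_family_change a p y b c :
  chart_dom (A b) p -> chart_dom (A c) p ->
  coord_family a p y c =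
  'd (transition (A b) (A c)) (chart_map (A b) p) (coord_family a p y b).
Proof.
move=> bp cp; rewrite /coord_family; case: asboolP => [[ap _]|nac].
  by rewrite asboolT //; exact: transition_cocycle.
rewrite asboolF ?linear0 // => -[ap _]; exact: nac.
Qed.

Fact coord_family_off a p y b :
  ~ chart_dom (A b) p -> coord_family a p y b = 0.
Proof. by move=> nbp; rewrite /coord_family asboolF // => -[]. Qed.

(* The tangent vector y^i d/dx^i at p, in the coordinates of the chart a. It is
   only meaningful for p in the domain of a (elsewhere it is the zero vector).
   The next two lemmas say that it is inverse to taking components in a. *)
Definition tangent_of_coord (a : chart_index A) (p : M) (y : 'rV[R]_n) :
    tangent A p :=
  Tangent (@coord_family_change a p y) (@coord_family_off a p y).

Lemma tangent_of_coordK a p : chart_dom (A a) p ->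
  cancel (tangent_of_coord a p) (fun v => tcoord v a).
Proof.
by move=> ap y; rewrite /= /coord_family asboolT //; exact: transition_id.
Qed.

Lemma tcoordK a p : chart_dom (A a) p ->
  cancel (fun v : tangent A p => tcoord v a) (tangent_of_coord a p).
Proof.
move=> ap v; have : tcoord (tangent_of_coord a p (tcoord v a)) = tcoord v.
  apply/funext => b; rewrite /= /coord_family; case: asboolP => [[_ bp]|nb].
    exact/esym/tcoord_change.
  by rewrite tcoord_off // => bp; exact: nb.
case: v (tangent_of_coord _ _ _) => [v v1 v2] [w w1 w2] /= wv.
by case: _ / wv in v1 v2 *; congr Tangent; exact: Prop_irrelevance.
Qed.

(* The expression F(x, y) of F in the induced coordinates (x^i, y^i). *)
Definition local_expr (F : tangent_bundle A -> R) (a : chart_index A)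
    (u : 'rV[R]_n * 'rV[R]_n) : R :=
  let p := chart_inv (A a) u.1 in F (existT _ p (tangent_of_coord a p u.2)).

Definition slit (a : chart_index A) : set ('rV[R]_n * 'rV[R]_n) :=
  [set u | chart_img (A a) u.1 /\ u.2 != 0].

Definition local_field (B : forall p : M, tangent A p) (a : chart_index A)
    (x : 'rV[R]_n) : 'rV[R]_n :=
  tcoord (B (chart_inv (A a) x)) a.

End TangentOfCoord.

(* Tensor calculus in one induced chart: f is the local expression of F, b that
   of a vector field, and a point u = (x, y). *)
Section LocalTensors.
Context (R : realType) (n : nat).
Implicit Types (f : 'rV[R]_n * 'rV[R]_n -> R) (u : 'rV[R]_n * 'rV[R]_n).
Implicit Types (b : 'rV[R]_n -> 'rV[R]_n) (i j k h : 'I_n).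

Definition dx i f : 'rV[R]_n * 'rV[R]_n -> R := 'D_((delta_mx 0 i, 0)) f.

Definition dy i f : 'rV[R]_n * 'rV[R]_n -> R := 'D_((0, delta_mx 0 i)) f.

Definition sqr f u : R := f u ^+ 2.

Definition gmx f u : 'M[R]_n := \matrix_(i, j) (2^-1 * dy i (dy j (sqr f)) u).

Definition g_low f i j u : R := gmx f u i j.

Definition g_up f i j u : R := invmx (gmx f u) i j.

Definition cartan f i j k u : R := 2^-1 * dy k (g_low f i j) u.

Definition l_low f i u : R := dy i f u.

Definition angular f i j u : R := g_low f i j u - l_low f i u * l_low f j u.

Definition cartan1 f i u : R :=
  \sum_(j < n) \sum_(k < n) cartan f i j k u * g_up f j k u.

Definition spray f i u : R :=
  4^-1 * \sum_(h < n) g_up f i h u *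
    (\sum_(r < n) u.2 0 r * dx r (dy h (sqr f)) u - dx h (sqr f) u).

Definition nonlinear_conn f i j u : R := dy j (spray f i) u.

Definition delta f i (t : 'rV[R]_n * 'rV[R]_n -> R) u : R :=
  dx i t u - \sum_(r < n) nonlinear_conn f r i u * dy r t u.

Definition Gamma f i j k u : R :=
  2^-1 * \sum_(r < n) g_up f i r u *
    (delta f j (g_low f k r) u + delta f k (g_low f j r) u
     - delta f r (g_low f j k) u).

Definition hcov f b i j u : R :=
  delta f j (fun w => b w.1 0 i) u + \sum_(m < n) b u.1 0 m * Gamma f i m j u.

End LocalTensors.

Record finsler_structure (R : realType) (n : nat) (M : topologicalType)
    (A : smooth_manifold R n M) (F : tangent_bundle A -> R) : Prop := {
  finsler_ge0 : forall v, 0 <= F v;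
  finsler_at0 : forall a x, chart_img (A a) x -> local_expr F a (x, 0) = 0;
  finsler_smooth : forall a, smooth_on (slit a) (local_expr F a);
  finsler_homogeneous : forall a x y (t : R), chart_img (A a) x -> 0 < t ->
    local_expr F a (x, t *: y) = t * local_expr F a (x, y);
  finsler_posdef : forall a u, slit a u -> forall w : 'rV[R]_n, w != 0 ->
    0 < \sum_(i < n) \sum_(j < n)
          g_low (local_expr F a) i j u * w 0 i * w 0 j }.

Definition smooth_vector_field (R : realType) (n : nat) (M : topologicalType)
    (A : smooth_manifold R n M) (B : forall p, tangent A p) : Prop :=
  forall a, smooth_on (chart_img (A a)) (local_field B a).

Definition nowhere_vanishing (R : realType) (n : nat) (M : topologicalType)
    (A : smooth_manifold R n M) (B : forall p, tangent A p) : Prop :=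
  forall p a, chart_dom (A a) p -> tcoord (B p) a != 0.


Definition SC_field (R : realType) (n : nat) (M : topologicalType)
    (A : smooth_manifold R n M) (F : tangent_bundle A -> R)
    (B : forall p, tangent A p) : Prop :=
  [/\ smooth_vector_field B, nowhere_vanishing B &
      forall a u, slit a u -> forall i j,
        \sum_(h < n) local_field B a u.1 0 h *
                     cartan (local_expr F a) h i j u = 0].

Definition reversible (R : realType) (n : nat) (M : topologicalType)
    (A : smooth_manifold R n M) (F : tangent_bundle A -> R) : Prop :=
  forall a x y, chart_img (A a) x ->
    local_expr F a (x, - y) = local_expr F a (x, y).

Definition C_reducible (R : realType) (n : nat) (M : topologicalType)
    (A : smooth_manifold R n M) (F : tangent_bundle A -> R) : Prop :=
  (3 <= n)%N /\
  forall a u, slit a u -> forall i j k,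
    let f := local_expr F a in
    cartan f i j k u =
    (n.+1%:R)^-1 * (angular f i j u * cartan1 f k u
                    + angular f k i u * cartan1 f j u
                    + angular f j k u * cartan1 f i u).

Definition berwaldian (R : realType) (n : nat) (M : topologicalType)
    (A : smooth_manifold R n M) (F : tangent_bundle A -> R) : Prop :=
  forall a u, slit a u -> forall h i j k,
    dy i (dy j (dy k (spray (local_expr F a) h))) u = 0.

Definition hcov_nondegenerate (R : realType) (n : nat) (M : topologicalType)
    (A : smooth_manifold R n M) (F : tangent_bundle A -> R)
    (B : forall p, tangent A p) : Prop :=
  forall a u, slit a u ->
    \det (\matrix_(i < n, j < n)
            hcov (local_expr F a) (local_field B a) i j u) != 0.

Definition riemannian (R : realType) (n : nat) (M : topologicalType)
    (A : smooth_manifold R n M) (F : tangent_bundle A -> R) : Prop :=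
  forall a u, slit a u -> forall i j k, cartan (local_expr F a) i j k u = 0.

(* Main.v *)
Require Import Defs.
From mathcomp Require Import all_boot all_order all_algebra.
From mathcomp Require Import all_classical all_reals all_analysis.
Set Implicit Arguments.
Unset Strict Implicit.
Unset Printing Implicit Defensive.
Import Order.TTheory GRing.Theory Num.Theory numFieldNormedType.Exports.
Local Open Scope classical_set_scope.
Local Open Scope ring_scope.

(** Everything happens in one tangent space, so fix x and put phi y = F(x, y)^2
    and b = B(x). Up to the factor 4, the Cartan tensor consists of the third
    derivatives of phi, and each first derivative E = d phi/dy^i is smooth on
    y != 0 and positively homogeneous of degree 1.

    Contracting the Cartan tensor with b gives zero, which says that the
    function D_b E has zero gradient. Hence E is affine along every line of
    direction b that avoids the origin: E(y + t b) = E(y) + t p with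
    p = D_b E(y). Homogeneity turns the behaviour at t -> +oo into the behaviour
    near the point b, which is a point of the slit tangent space where E is
    differentiable: for s > 0,
      E(b + s y) = s E(y + b / s) = p + s E(y).
    Letting s tend to 0 gives p = E(b) and then E(y) = dE_b(y). So off the line
    R b the function E coincides with a single linear form
    ([linear_off_axis]), and if the space is not reduced to R b this extends by
    continuity to all y != 0 ([linear_on_slit_of_axis]). The second derivatives
    of phi are then constant on the slit tangent space, and the third ones
    vanish. If the space is R b, the contraction with b is already the whole
    tensor ([third_derivative_eq0_of_axis]).

    The order of differentiation is never exchanged: the index contracted with
    b stands in the middle derivative, and this is exactly what makes the
    outermost derivative the gradient of D_b E. *)

(** * C^k functions *)

(** The rules of differentiation identify the derivative of a sum or a product
    only at points of the open set where the factors are differentiable, so the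
    induction on k needs to pass between total functions that agree there. *)
Lemma near_eq_differentiable {R : realType} {V W : normedModType R}
    (f g : V -> W) (x : V) :
  (\forall z \near x, f z = g z) -> differentiable f x -> differentiable g x.
Proof.
move=> fg /diff_locallyP[df ef].
have fgx : f x = g x := nbhs_singleton fg.
suff eg : g \o shift x = cst (g x) + 'd f x +o_ 0 id.
  by apply/diff_locallyP; rewrite (diff_unique df eg).
(* The expansion of f with its own differential is also one of g. *)
rewrite (near_shift 0) subr0 in fg.
apply/eqaddoP => e e0; move/eqaddoP: ef => /(_ e e0); apply: filterS2 fg => h.
by rewrite !fctE /= fgx => ->.
Qed.

Lemma Ck_on_eq {R : realType} {V W : normedModType R} (k : nat) (U : set V)
    (f g : V -> W) :
  open U -> (forall x, U x -> f x = g x) -> Ck_on k U f -> Ck_on k U g.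
Proof.
move=> oU; elim: k f g => [|k IH] f g fg /=.
  move=> cf x Ux; have fgx := open_nbhs_nbhs (conj oU Ux).
  rewrite /prop_for /continuous_at -fg//; apply: cvg_trans (cf x Ux).
  by apply: near_eq_cvg; apply: filterS fgx => z /fg.
move=> [df Df]; have near_fg x : U x -> \forall z \near x, f z = g z.
  by move=> Ux; apply: filterS (open_nbhs_nbhs (conj oU Ux)) => z /fg.
split=> [x Ux|v]; first exact: near_eq_differentiable (near_fg _ Ux) (df x Ux).
by apply: IH (Df v) => x Ux; apply/near_eq_derive/near_fg.
Qed.

Lemma Ck_onS {R : realType} {V W : normedModType R} (k : nat) (U : set V)
    (f : V -> W) : Ck_on k.+1 U f -> Ck_on k U f.
Proof.
elim: k f => [|k IH] f [df Df]; last by split=> // v; exact: IH.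
by move=> x Ux; apply/differentiable_continuous/df.
Qed.

Lemma Ck_onD {R : realType} {V W : normedModType R} (k : nat) (U : set V)
    (f g : V -> W) : open U -> Ck_on k U f -> Ck_on k U g -> Ck_on k U (f + g).
Proof.
move=> oU; elim: k f g => [|k IH] f g /=.
  by move=> cf cg x Ux; apply: cvgD; [exact: cf|exact: cg].
move=> [df Df] [dg Dg]; split=> [x Ux|v].
  by apply: differentiableD; [exact: df|exact: dg].
apply: Ck_on_eq oU _ (IH _ _ (Df v) (Dg v)) => x Ux /=.
by rewrite deriveD//; apply: diff_derivable; [exact: df|exact: dg].
Qed.

Lemma Ck_onM {R : realType} {V : normedModType R} (k : nat) (U : set V)
    (f g : V -> R) : open U -> Ck_on k U f -> Ck_on k U g -> Ck_on k U (f * g).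
Proof.
move=> oU; elim: k f g => [|k IH] f g.
  by move=> cf cg x Ux; apply: cvgM; [exact: cf|exact: cg].
move=> Cf Cg; have [df Df] := Cf; have [dg Dg] := Cg; split=> [x Ux|v].
  by apply: differentiableM; [exact: df|exact: dg].
have := Ck_onD oU (IH _ _ (Ck_onS Cf) (Dg v)) (IH _ _ (Ck_onS Cg) (Df v)).
apply: Ck_on_eq oU _ => x Ux.
by rewrite deriveM//; apply: diff_derivable; [exact: df|exact: dg].
Qed.

(** * Directional derivatives along lines *)

(** Both derivatives are the limit of literally the same difference quotient, so
    derivability in the single direction v suffices. *)
Lemma is_derive_line {R : realType} {V W : normedModType R} (f : V -> W)
    (v y : V) (t : R) :
  derivable f (t *: v + y) v ->
  is_derive t (1 : R) (fun s : R => f (s *: v + y)) ('D_v f (t *: v + y)).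
Proof.
have e : (fun h : R => h^-1 *: (((fun s : R => f (s *: v + y)) \o shift t)
            (h *: (1 : R)) - f (t *: v + y)))
  = (fun h => h^-1 *: ((f \o shift (t *: v + y)) (h *: v) - f (t *: v + y))).
  by apply/funext => h /=; rewrite [h *: 1]mulr1 scalerDl addrA.
by move=> df; apply: DeriveDef; rewrite ?/derivable ?/derive e.
Qed.

Lemma cvg_line {R : realType} {V W : normedModType R} (f : V -> W) (v y : V) :
  {for y, continuous f} -> f (s *: v + y) @[s --> (0 : R)] --> f y.
Proof.
move=> cf; suff h : s *: v + y @[s --> (0 : R)] --> y by exact: cvg_comp h cf.
have : s *: v + y @[s --> (0 : R)] --> 0 *: v + y.
  by apply: cvgD; [exact: scalel_continuous|exact: cvg_cst].
by rewrite scale0r add0r.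
Qed.

Lemma affine_along_line {R : realType} {V : normedModType R} (E : V -> R)
    (b y : V) :
  (forall t : R, derivable E (t *: b + y) b) ->
  (forall t : R, 'D_b E (t *: b + y) = 'D_b E y) ->
  forall t, E (t *: b + y) = E y + t * 'D_b E y.
Proof.
move=> dE cE t; pose p := 'D_b E y.
pose g (s : R) : R := E (s *: b + y) - s * p.
suff /eqP : g t = g 0.
  by rewrite /g mul0r subr0 scale0r add0r subr_eq => /eqP.
apply: is_derive_0_is_cst => s.
have d1 := is_derive_line (dE s).
have d2 : is_derive s (1 : R) (fun s : R => s * p) p.
  have := @is_deriveM R R id (cst p) s 1 1 0 (is_derive_id s 1)
            (is_derive_cst p s 1).
  by rewrite scaler0 add0r /GRing.scale/= mulr1.
by have := is_deriveB d1 d2; rewrite cE subrr.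
Qed.

(** The axis is the line R b. Seen from y, the point at infinity of the line
    t b + y is, after rescaling by s = 1 / t, the point b itself, so that the
    affine function t |-> E (t b + y) determines the first-order behaviour of E
    at b in the direction y; conversely E y is read off from it. *)
Lemma linear_off_axis {R : realType} {V : normedModType R} (E : V -> R)
    (b y : V) :
  (forall (t : R) z, 0 < t -> z != 0 -> E (t *: z) = t * E z) ->
  (forall z, z != 0 -> differentiable E z) -> b != 0 ->
  (forall t : R, t *: b + y != 0) ->
  (forall t : R, 'D_b E (t *: b + y) = 'D_b E y) ->
  E y = 'd E b y.
Proof.
move=> hE dE b0 yb cE.
have aff t : E (t *: b + y) = E y + t * 'D_b E y.
  by apply: affine_along_line => // s; apply/diff_derivable/dE.
set p := 'D_b E y in aff.
have line s : 0 < s -> E (s *: y + b) = p + s * E y.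
  move=> s0; have -> : s *: y + b = s *: (s^-1 *: b + y).
    by rewrite scalerDr scalerA divff ?gt_eqF// scale1r addrC.
  by rewrite hE// aff mulrDr mulrA divff ?gt_eqF// mul1r addrC.
have cEb : E (s *: y + b) @[s --> (0 : R)^'+] --> E b.
  by apply: cvg_at_right_filter; apply/cvg_line/differentiable_continuous/dE.
(* The constant term: E is continuous at b. *)
have Eb : E b = p.
  apply: (cvg_unique _ cEb) => //.
  have h : p + s * E y @[s --> (0 : R)^'+] --> p + 0 * E y.
    apply: cvg_at_right_filter; apply: cvgD; first exact: cvg_cst.
    by apply: cvgMl; exact: cvg_id.
  rewrite mul0r addr0 in h.
  apply: cvg_trans h; apply: near_eq_cvg; near=> s.
  by rewrite line.
rewrite -deriveE; last exact: dE.
have dEb := @diff_derivable _ _ _ _ _ y (dE b b0).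
(* The slope: the right-hand difference quotients of E at b in the direction y
   are constantly E y. *)
have cq : (fun h : R => h^-1 *: ((E \o shift b) (h *: y) - E b)) @ 0^'+
    --> 'D_y E b by exact/cvg_dnbhs_at_right/dEb.
apply: (cvg_unique _ _ cq) => //.
have : (fun=> E y) @ (0 : R)^'+ --> E y by exact: cvg_cst.
apply: cvg_trans; apply: near_eq_cvg; near=> s.
have s0 : 0 < s by [].
rewrite /= line// Eb addrAC subrr add0r /GRing.scale/= mulrA mulVf ?mul1r//.
Unshelve. all: by end_near. Qed.

(** * Restriction to a fiber *)

Lemma derive_fiber {R : realType} {U V W : normedModType R} (f : U * V -> W)
    (x : U) (y w : V) :
  'D_w (fun z => f (x, z)) y = 'D_((0, w)) f (x, y).
Proof.
have e : (fun h : R => h^-1 *: (((fun z => f (x, z)) \o shift y) (h *: w)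
                                - f (x, y)))
       = (fun h : R => h^-1 *: ((f \o shift (x, y)) (h *: (0, w)) - f (x, y))).
  apply/funext => h /=; congr (_ *: (f _ - _)).
  by congr pair; rewrite /= scaler0 add0r.
by rewrite /derive e.
Qed.

Lemma Ck_on_fiber {R : realType} {U V W : normedModType R} (k : nat)
    (S : set (U * V)) (f : U * V -> W) (x : U) :
  Ck_on k S f -> Ck_on k [set y | S (x, y)] (fun y => f (x, y)).
Proof.
have dx y : differentiable (fun y : V => (x, y)) y.
  by apply: differentiable_pair; [exact: differentiable_cst|exact: ex_diff].
elim: k f => [|k IH] f /=.
  move=> cf y Sy; apply: (@continuous_comp _ _ _ (pair x) f).
    exact/differentiable_continuous/dx.
  exact: cf.
move=> [df Df]; split=> [y Sy|v].
  by apply: (differentiable_comp (dx y)); exact: df.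
have -> : 'D_v (fun y => f (x, y)) = (fun y => 'D_((0, v)) f (x, y)).
  by apply/funext => y; exact: derive_fiber.
exact: (IH ('D_((0, v)) f) (Df _)).
Qed.

(** * Homogeneous functions with a degenerate direction *)

Lemma open_nonzero {R : realType} (V : normedModType R) :
  open [set y : V | y != 0].
Proof.
have -> : [set y : V | y != 0] = ~` [set 0].
  by apply/seteqP; split=> y /= /eqP.
apply: closed_openC; apply: accessible_closed_set1.
exact/hausdorff_accessible/norm_hausdorff.
Qed.

(** Differentiate phi (t y) = t^2 phi y in y: the chain rule produces one factor
    t on the left. *)
Lemma derive_homogeneous {R : realType} {V : normedModType R} (phi : V -> R)
    (v : V) :
  (forall (t : R) z, 0 < t -> z != 0 -> phi (t *: z) = t ^+ 2 * phi z) ->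
  (forall z, z != 0 -> differentiable phi z) ->
  forall (t : R) z, 0 < t -> z != 0 ->
    'D_v phi (t *: z) = t * 'D_v phi z.
Proof.
move=> hphi dphi t z t0 z0.
have tz0 : t *: z != 0 by rewrite scaler_eq0 gt_eqF.
have nz : \forall y \near z, (phi \o ( *:%R t)) y = (t ^+ 2 *: phi) y.
  have oz : open_nbhs z [set y | y != 0].
    by split=> //; exact: open_nonzero.
  by apply: filterS (open_nbhs_nbhs oz) => y y0; rewrite /= hphi.
have dt : differentiable ( *:%R t : V -> V) z by exact: ex_diff.
have := near_eq_derive v nz; rewrite deriveZ; last exact/diff_derivable/dphi.
rewrite deriveE; last by apply: differentiable_comp => //; exact: dphi.
rewrite diff_comp//; last exact: dphi.
rewrite /= diff_val linearZ /= -deriveE; last exact: dphi.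
rewrite /GRing.scale /= expr2 -mulrA => /(mulfI _); apply.
by rewrite gt_eqF.
Qed.

(** The third hypothesis says that all partial derivatives of D_b E vanish, and
    w witnesses that the line R b is not the whole space. The point z may lie on
    R b; it is then approached along z + s w, which leaves R b at once. *)
Lemma linear_on_slit_of_axis {R : realType} (n : nat) (E : 'rV[R]_n -> R)
    (b w : 'rV[R]_n) :
  Ck_on 2 [set y | y != 0] E ->
  (forall (t : R) z, 0 < t -> z != 0 -> E (t *: z) = t * E z) ->
  (forall z j, z != 0 ->
     \sum_(h < n) b 0 h * 'D_(delta_mx 0 j) ('D_(delta_mx 0 h) E) z = 0) ->
  b != 0 -> (forall t : R, t *: b + w != 0) ->
  forall z, z != 0 -> E z = 'd E b z.
Proof.
move=> [dE DE] hE SC b0 wb.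
have dDE v z : z != 0 -> differentiable ('D_v E) z.
  by case: (DE v) => + _; apply.
pose P : 'rV[R]_n -> R := \sum_(h < n) (b 0 h *: 'D_(delta_mx 0 h) E).
have dP z : z != 0 -> differentiable P z.
  by move=> z0; apply: differentiable_sum => h; apply/differentiableZ/dDE.
have DbE z : z != 0 -> 'D_b E z = P z.
  move=> z0; rewrite deriveE; last exact: dE.
  rewrite [in LHS](row_sum_delta b) linear_sum /P fct_sumE.
  by apply: eq_bigr => h _; rewrite linearZ /= -deriveE//; exact: dE.
have DbP z : z != 0 -> 'D_b P z = 0.
  move=> z0; rewrite deriveE; last exact: dP.
  rewrite (row_sum_delta b) linear_sum big1// => j _; rewrite linearZ /=.
  rewrite -deriveE; last exact: dP.
  rewrite derive_sum; last first.
    by move=> h; apply/diff_derivable/differentiableZ/dDE.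
  rewrite (eq_bigr (fun h =>
             b 0 h * 'D_(delta_mx 0 j) ('D_(delta_mx 0 h) E) z)).
    by rewrite SC// scaler0.
  by move=> h _; rewrite deriveZ//; exact/diff_derivable/dDE.
(* D_b P = 0 makes P = D_b E constant on the lines of direction b. *)
have off z : (forall t : R, t *: b + z != 0) -> E z = 'd E b z.
  move=> zb; apply: linear_off_axis => // t.
  have z0 : z != 0 by have := zb 0; rewrite scale0r add0r.
  rewrite !DbE//.
  have -> : P z = P (0 *: b + z) by rewrite scale0r add0r.
  apply: (@is_derive_0_is_cst _ (fun s => P (s *: b + z))) => s.
  by rewrite -(DbP (s *: b + z))//; apply/is_derive_line/diff_derivable/dP.
move=> z z0; have [zb|] := pselect (forall t : R, t *: b + z != 0).
  exact: off.
move=> /existsNP[t /negP]; rewrite negbK addr_eq0 => /eqP zt.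
have cE : E (s *: w + z) @[s --> (0 : R)^'] --> E z.
  by apply: cvg_within_filter; apply/cvg_line/differentiable_continuous/dE.
have cL : 'd E b (s *: w + z) @[s --> (0 : R)^'] --> 'd E b z.
  apply: cvg_within_filter; apply/cvg_line.
  exact/diff_continuous/dE.
apply: (cvg_unique _ cE) => //.
apply: cvg_trans cL; apply: near_eq_cvg; near=> s.
have s0 : s != 0 by near: s; exact: nbhs_dnbhs_neq.
apply/esym/off => r.
have -> : r *: b + (s *: w + z) = s *: ((s^-1 * (r - t)) *: b + w).
  rewrite scalerDr scalerA mulrA divff// mul1r scalerBl zt opprK.
  by rewrite addrA addrAC.
by rewrite scaler_eq0 negb_or s0 wb.
Unshelve. all: by end_near. Qed.

(** If some vector lies outside R b, the function D_j phi is linear, its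
    derivative is constant, and the next derivative is zero. When R b is the
    whole space, each basis vector is a multiple of b, and the hypothesis
    contracted with b becomes the vanishing of each component. *)
Lemma third_derivative_eq0_of_axis {R : realType} (n : nat)
    (phi : 'rV[R]_n -> R) (b : 'rV[R]_n) :
  Ck_on 3 [set y | y != 0] phi ->
  (forall (t : R) z, 0 < t -> z != 0 -> phi (t *: z) = t ^+ 2 * phi z) ->
  b != 0 ->
  (forall z i j, z != 0 ->
     \sum_(h < n) b 0 h * 'D_(delta_mx 0 j) ('D_(delta_mx 0 h)
                             ('D_(delta_mx 0 i) phi)) z = 0) ->
  forall z i j k, z != 0 ->
    'D_(delta_mx 0 k) ('D_(delta_mx 0 i) ('D_(delta_mx 0 j) phi)) z = 0.
Proof.
move=> [dphi Dphi] hphi b0 SC z i j k z0.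
have [/existsNP[w /forallNP wb]|] :=
    pselect (~ forall w, exists t : R, t *: b + w = 0).
  have wb' (t : R) : t *: b + w != 0 by apply/eqP/wb.
  have nz (y : 'rV[R]_n) : y != 0 -> \forall x \near y, x != 0.
    by move=> y0; exact: open_nbhs_nbhs (conj (@open_nonzero _ _) y0).
  set E := 'D_(delta_mx 0 j) phi.
  have EL y : y != 0 -> E y = 'd E b y.
    apply: (linear_on_slit_of_axis (Dphi _) _ _ b0 wb').
      exact: derive_homogeneous.
    by move=> *; exact: SC.
  have dE : differentiable E b by case: (Dphi (delta_mx 0 j)) => + _; apply.
  have DE y : y != 0 -> 'D_(delta_mx 0 i) E y = 'd E b (delta_mx 0 i).
    move=> y0; rewrite (@near_eq_derive _ _ _ _ ('d E b)); last first.
      by apply: filterS (nz _ y0) => x; exact: EL.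
    have cL : continuous ('d E b) by exact: diff_continuous.
    rewrite deriveE; last exact: linear_differentiable.
    by rewrite diff_lin.
  rewrite (@near_eq_derive _ _ _ _ (cst ('d E b (delta_mx 0 i)))).
    exact: derive_cst.
  by apply: filterS (nz _ z0) => x; exact: DE.
move=> /contrapT /(_ (delta_mx 0 i))[t /eqP].
rewrite addrC addr_eq0 => /eqP eb.
transitivity (\sum_(h < n) (delta_mx 0 i : 'rV[R]_n) 0 h *
  'D_(delta_mx 0 k) ('D_(delta_mx 0 h) ('D_(delta_mx 0 j) phi)) z).
  rewrite (bigD1 i)//= mxE !eqxx mul1r big1 ?addr0// => h hi.
  by rewrite mxE (negbTE hi) andbF mul0r.
rewrite eb (eq_bigr (fun h => - t * (b 0 h *
  'D_(delta_mx 0 k) ('D_(delta_mx 0 h) ('D_(delta_mx 0 j) phi)) z))).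
  by rewrite -mulr_sumr SC// mulr0.
by move=> h _; rewrite !mxE !mulNr mulrA.
Qed.

(** * The Cartan tensor *)

Lemma cartanE {R : realType} (n : nat) (f : 'rV[R]_n * 'rV[R]_n -> R)
    (x y : 'rV[R]_n) (i j k : 'I_n) (phi := fun z => sqr f (x, z)) :
  Ck_on 3 [set z | z != 0] phi -> y != 0 ->
  cartan f i j k (x, y) =
  4^-1 * 'D_(delta_mx 0 k) ('D_(delta_mx 0 i) ('D_(delta_mx 0 j) phi)) y.
Proof.
move=> [_ Dphi] y0; rewrite /cartan /dy -derive_fiber.
have ej : (fun z => 'D_((0, delta_mx 0 j)) (sqr f) (x, z)) =
    'D_(delta_mx 0 j) phi.
  by apply/funext => z; rewrite -derive_fiber.
have -> : (fun z => g_low f i j (x, z)) =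
    2^-1 \*: 'D_(delta_mx 0 i) ('D_(delta_mx 0 j) phi).
  by apply/funext => z; rewrite /g_low /gmx mxE /dy -derive_fiber ej.
rewrite deriveZ /GRing.scale/=.
  by rewrite mulrA -invfM -natrM.
apply: diff_derivable; have [_ DDphi] := Dphi (delta_mx 0 j).
by have [+ _] := DDphi (delta_mx 0 i); apply.
Qed.

Theorem theorem3p9 (R : realType) (n : nat) (M : topologicalType)
    (A : smooth_manifold R n M) (M_connected : connected [set: M])
    (F : tangent_bundle A -> R) (F_finsler : finsler_structure F)
    (B : forall p : M, tangent A p) (B_SC : SC_field F B)
    (alternatives :
      [\/ n = 2%N,
          n = 3%N /\ reversible F,
          C_reducible F
        | berwaldian F /\ hcov_nondegenerate F B]) :
  riemannian F.
Proof.
case: B_SC => _ B0 SC a [x y] [/= ax y0] i j k.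
set f := local_expr F a.
pose phi z := sqr f (x, z).
have Cphi : Ck_on 3 [set z | z != 0] phi.
  have Cf : Ck_on 3 [set z | z != 0] (fun z => f (x, z)).
    have := Ck_on_fiber x (finsler_smooth F_finsler a 3).
    by congr Ck_on; apply/seteqP; split=> z //= [].
  have o0 := @open_nonzero R 'rV[R]_n.
  apply: Ck_on_eq o0 _ (Ck_onM o0 Cf Cf) => z _.
  by rewrite /phi /sqr expr2.
have [ap _] := chart_imgP ax.
rewrite cartanE// (third_derivative_eq0_of_axis Cphi _ (B0 _ _ ap)) ?mulr0//.
  move=> t z t0 z0; rewrite /phi /sqr /f.
  by rewrite (finsler_homogeneous F_finsler)// exprMn.
move=> z h l z0; have /(_ h l) := SC a (x, z) (conj ax z0).
under eq_bigr => m _ do rewrite cartanE// mulrCA.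
by rewrite -mulr_sumr => /eqP; rewrite mulf_eq0 invr_eq0 pnatr_eq0 => /eqP.
Qed.
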